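(* Let $R$ be a ring and let $M$ be a continuous left $R$-module. Then $\operatorname{End}_R(M)$ is right strongly exchange.
   Context: Rings are associative with identity. Homomorphisms of left modules are written on the right of their arguments, so that in $\operatorname{End}_R(M)$ (for a left $R$-module $M$) the product $fg$ means ''first $f$, then $g$'': $(x)fg=((x)f)g$. A left $R$-module $M$ is continuous if it satisfies: (C1) every submodule of $M$ is essential in a direct summand of $M$; (C2) any submodule of $M$ that is isomorphic to a direct summand of $M$ is itself a direct summand of $M$. For a ring $T$, a right coprime pair in $T$ is a pair of elements $a,b\in T$ with $aT+bT=T$. Two right coprime pairs $(a,b)$, $(a',b')$ are identified when $aT=a'T$ and $bT=b'T$; $\langle a,b\rangle$ denotes the equivalence class, $\mathrm{RCP}(T)$ the set of all classes, and a pair $(a',b')$ with $\langle a',b'\rangle=\langle a,b\rangle$ is called a pair of generators of $\langle a,b\rangle$. $\mathrm{RCP}(T)$ is partially ordered by $\langle a,b\rangle\le\langle a',b'\rangle$ iff $aT\subseteq a'T$ and $bT\subseteq b'T$. A compatible descending chain of right coprime pairs is a family $\{p_\alpha\mid\alpha<\kappa\}\subseteq \mathrm{RCP}(T)$ ($\kappa$ an ordinal, $p_\beta\le p_\alpha$ for $\alpha<\beta<\kappa$) such that there exist a pair of generators $(a_\alpha,b_\alpha)$ of $p_\alpha$ for each $\alpha<\kappa$, and elements $r_{\alpha\beta},s_{\alpha\beta}\in T$ for $\alpha<\beta<\kappa$, with $a_\beta=a_\alpha r_{\alpha\beta}$ and $b_\beta=b_\alpha s_{\alpha\beta}$ for all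 $\alpha<\beta<\kappa$, and $r_{\alpha\beta}=r_{\alpha\gamma}r_{\gamma\beta}$, $s_{\alpha\beta}=s_{\alpha\gamma}s_{\gamma\beta}$ for all $\alpha<\gamma<\beta<\kappa$. A minimal lower bound of a chain is a lower bound of the chain in $\mathrm{RCP}(T)$ that is a minimal element of the poset $\mathrm{RCP}(T)$. The ring $T$ is right strongly exchange if every compatible descending chain of right coprime pairs of $T$ has a minimal lower bound. *)

(* Defs.v *)
From HB Require Import structures.
From mathcomp Require Import all_boot all_order ssralg generic_quotient.
From mathcomp Require Import all_classical wochoice.

Set Implicit Arguments.
Unset Strict Implicit.
Unset Printing Implicit Defensive.

Import Order.TTheory GRing.Theory.

Local Open Scope quotient_scope.
Local Open Scope classical_set_scope.
Local Open Scope ring_scope.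

Section ContinuousModule.
Variables (R : pzRingType) (M : lmodType R).
Implicit Types N K L : {pred M}.

Definition direct_summand K : Prop :=
  submod_closed K /\
  exists L, [/\ submod_closed L,
    forall x, exists2 k, k \in K & exists2 l, l \in L & x = k + l
    & forall x, x \in K -> x \in L -> x = 0].

Definition essential_in N K : Prop :=
  {subset N <= K} /\
  forall L, submod_closed L -> {subset L <= K} ->
    (forall x, x \in L -> x \in N -> x = 0) -> forall x, x \in L -> x = 0.

(* A homomorphism N -> K of submodules is encoded by a function on M of which
   only the values on N matter; it need not extend to a linear map on M. *)
Definition submod_isomorphic N K : Prop :=
  exists f : M -> M,
    [/\ {in N &, {morph f : x y / x + y}},
        forall a, {in N, {morph f : x / a *: x}},
        {in N, forall x, f x \in K},
        {in N &, injective f}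
      & {in K, forall y, exists2 x, x \in N & f x = y}].

Definition module_C1 : Prop :=
  forall N, submod_closed N -> exists2 K, direct_summand K & essential_in N K.

Definition module_C2 : Prop :=
  forall N K, submod_closed N -> direct_summand K -> submod_isomorphic N K ->
    direct_summand N.

Definition continuous_module : Prop := module_C1 /\ module_C2.

End ContinuousModule.

Definition Endo (R : pzRingType) (M : lmodType R) : Type := {linear M -> M}.

Section EndoRing.
Variables (R : pzRingType) (M : lmodType R).
Implicit Types f g h : Endo M.

HB.instance Definition _ := gen_eqMixin (Endo M).
HB.instance Definition _ := gen_choiceMixin (Endo M).

Definition endo_fun f : M -> M := (f : {linear M -> M}).

Lemma endoP f g : endo_fun f =1 endo_fun g -> f = g.
Proof.
rewrite /endo_fun.
case: f g => [f [[f1] [f2]]] [g [[g1] [g2]]] /= fg.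
have {fg}efg : f = g by apply/funext.
move: g1 g2; rewrite -efg => g1 g2.
by rewrite (Prop_irrelevance f1 g1) (Prop_irrelevance f2 g2).
Qed.

Definition endo_zero : Endo M := (\0 : M -> M).
Definition endo_opp f : Endo M := (\- (f : {linear M -> M})).
Definition endo_add f g : Endo M :=
  ((f : {linear M -> M}) \+ (g : {linear M -> M})).
Definition endo_one : Endo M := @idfun M.
(* Endomorphisms act on the right of their arguments, so f g is first f,
   then g. *)
Definition endo_mul f g : Endo M :=
  ((g : {linear M -> M}) \o (f : {linear M -> M})).

Fact endo_addA : associative endo_add.
Proof. by move=> f g h; apply: endoP => x; exact: addrA. Qed.
Fact endo_addC : commutative endo_add.
Proof. by move=> f g; apply: endoP => x; exact: addrC. Qed.
Fact endo_add0 : left_id endo_zero endo_add.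
Proof. by move=> f; apply: endoP => x; exact: add0r. Qed.
Fact endo_addN : left_inverse endo_zero endo_opp endo_add.
Proof. by move=> f; apply: endoP => x; exact: addNr. Qed.
Fact endo_mulA : associative endo_mul.
Proof. by move=> f g h; apply: endoP. Qed.
Fact endo_mul1 : left_id endo_one endo_mul.
Proof. by move=> f; apply: endoP. Qed.
Fact endo_mulr1 : right_id endo_one endo_mul.
Proof. by move=> f; apply: endoP. Qed.
Fact endo_mulDl : left_distributive endo_mul endo_add.
Proof. by move=> f g h; apply: endoP => x; exact: (raddfD (h : {linear M -> M})). Qed.
Fact endo_mulDr : right_distributive endo_mul endo_add.
Proof. by move=> f g h; apply: endoP. Qed.

HB.instance Definition _ := GRing.isPzRing.Build (Endo M)
  endo_addA endo_addC endo_add0 endo_addN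
  endo_mulA endo_mul1 endo_mulr1 endo_mulDl endo_mulDr.

End EndoRing.

Section RightCoprimePairs.
Variable T : pzRingType.

Definition principal_right (a : T) : set T := [set a * t | t in setT].

Definition right_coprime (ab : T * T) : Prop :=
  [set x + y | x in principal_right ab.1 & y in principal_right ab.2] = setT.

Definition rcpair := {ab : T * T | `[< right_coprime ab >]}.

Definition rcpair_eqv (u v : rcpair) : bool :=
  `[< principal_right (val u).1 = principal_right (val v).1 /\
      principal_right (val u).2 = principal_right (val v).2 >].

Fact rcpair_eqv_refl : reflexive rcpair_eqv.
Proof. by move=> u; apply/asboolP. Qed.
Fact rcpair_eqv_sym : symmetric rcpair_eqv.
Proof. by move=> u v; apply/asboolP/asboolP => -[-> ->]. Qed.
Fact rcpair_eqv_trans : transitive rcpair_eqv.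
Proof.
move=> v u w /asboolP[uv1 uv2] /asboolP[vw1 vw2].
by apply/asboolP; rewrite uv1 uv2.
Qed.

Canonical rcpair_equiv :=
  EquivRel rcpair_eqv rcpair_eqv_refl rcpair_eqv_sym rcpair_eqv_trans.

Definition RCP := {eq_quot rcpair_equiv}.
HB.instance Definition _ := Choice.on RCP.
HB.instance Definition _ := EqQuotient.on RCP.

Definition generators (p : RCP) (a b : T) : Prop :=
  exists2 u : rcpair, val u = (a, b) & \pi_RCP u = p.

Definition rcpair_le (u v : rcpair) : Prop :=
  principal_right (val u).1 `<=` principal_right (val v).1 /\
  principal_right (val u).2 `<=` principal_right (val v).2.

Definition rcp_le (p q : RCP) : bool := `[< rcpair_le (repr p) (repr q) >].

Lemma rcp_le_pi (u v : rcpair) :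
  rcp_le (\pi_RCP u) (\pi_RCP v) = `[< rcpair_le u v >].
Proof.
have E w : rcpair_eqv (repr (\pi_RCP w)) w by apply/eqquotP; exact: reprK.
rewrite /rcp_le /rcpair_le.
by have /asboolP[-> ->] := E u; have /asboolP[-> ->] := E v.
Qed.

Fact rcp_le_refl : reflexive rcp_le.
Proof. by move=> p; apply/asboolP; split. Qed.
Fact rcp_le_anti : antisymmetric rcp_le.
Proof.
move=> p q /andP[/asboolP[pq1 pq2] /asboolP[qp1 qp2]].
rewrite -[p]reprK -[q]reprK; apply/eqquotP/asboolP.
by split; apply/seteqP; split.
Qed.
Fact rcp_le_trans : transitive rcp_le.
Proof.
move=> q p r /asboolP[pq1 pq2] /asboolP[qr1 qr2]; apply/asboolP.
by split; [exact: subset_trans pq1 qr1|exact: subset_trans pq2 qr2].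
Qed.

Fact rcp_display : Order.disp_t. Proof. exact: Order.Disp tt tt. Qed.

HB.instance Definition _ := Order.Le_isPOrder.Build rcp_display RCP
  rcp_le_refl rcp_le_anti rcp_le_trans.

Local Open Scope order_scope.

Definition compatible_descending_chain (d : Order.disp_t) (I : orderType d)
    (p : I -> RCP) : Prop :=
  (forall i j, i < j -> p j <= p i) /\
  exists (a b : I -> T) (r s : I -> I -> T),
    [/\ forall i, generators (p i) (a i) (b i),
        forall i j, i < j ->
          a j = (a i * r i j)%R /\ b j = (b i * s i j)%R
      & forall i k j, i < k -> k < j ->
          r i j = (r i k * r k j)%R /\ s i j = (s i k * s k j)%R].

Definition minimal_lower_bound (I : Type) (p : I -> RCP) (q : RCP) : Prop :=
  (forall i, q <= p i) /\ minimal (<=%O : rel RCP) q.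

(* Ordinals are represented by well-ordered types, which may be empty. *)
Definition right_strongly_exchange : Prop :=
  forall (d : Order.disp_t) (I : orderType d) (p : I -> RCP),
    well_order (<=%O : rel I) -> compatible_descending_chain p ->
    exists q, minimal_lower_bound p q.

End RightCoprimePairs.

(* Main.v *)
(** Let [(a_i, b_i)] be generators of the chain.  The submodules
    [N1 = \bigcup_i ker a_i] and [N2 = \bigcup_i ker b_i] meet trivially, since
    [ker a_i] and [ker b_i] do.  Enlarging them to summands by (C1) and using
    (C3), which follows from (C2), gives [M = K (+) L] with [N1] inside [K] and
    [N2] inside [L].  Let [e] be the projection onto [L] along [K].  For every
    [i], [a_i] is injective on [L] because [ker a_i] lies in [K], so [L a_i] is a
    summand by (C2); moreover [L a_i] and [K a_i] meet trivially, so by (C1) and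
    (C3) the summand [L a_i] has a complement containing [K a_i].  Inverting
    [a_i] on [L a_i] and killing that complement factors [e] through [a_i];
    symmetrically [1 - e] factors through [b_i].  So [<e, 1 - e>] is a lower
    bound of the chain, and such pairs are minimal because [e T] and [(1 - e) T]
    meet trivially. *)

Require Import Defs.
From mathcomp Require Import all_boot all_order ssralg.
From HB Require Import structures.
From mathcomp Require Import generic_quotient all_classical wochoice.

Set Implicit Arguments.
Unset Strict Implicit.
Unset Printing Implicit Defensive.

Import Order.TTheory GRing.Theory.

Local Open Scope quotient_scope.
Local Open Scope classical_set_scope.
Local Open Scope ring_scope.

(** * Splitting submodules of a continuous module *)

Section Decomposition.
Variables (R : pzRingType) (M : lmodType R).
Implicit Types (N K L P : {pred M}) (f g : {linear M -> M}).

Lemma submodD K x y : submod_closed K -> x \in K -> y \in K -> x + y \in K.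
Proof. by move=> [_ cK] xK yK; rewrite -(scale1r x); exact: cK. Qed.

Lemma submodZ K a x : submod_closed K -> x \in K -> a *: x \in K.
Proof. by move=> [K0 cK] xK; rewrite -(addr0 (a *: x)); exact: cK. Qed.

Lemma submodN K x : submod_closed K -> x \in K -> - x \in K.
Proof. by move=> cK xK; rewrite -scaleN1r; exact: submodZ. Qed.

Lemma submodB K x y : submod_closed K -> x \in K -> y \in K -> x - y \in K.
Proof. by move=> cK xK yK; apply: submodD => //; exact: submodN. Qed.

Definition complements K L : Prop :=
  [/\ submod_closed K, submod_closed L,
    forall x, exists2 k, k \in K & exists2 l, l \in L & x = k + l
    & forall x, x \in K -> x \in L -> x = 0].

Lemma complements_sym K L : complements K L -> complements L K.
Proof.
move=> [cK cL KL KL0]; split=> // [x|x xL xK]; last exact: KL0.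
have [k kK [l lL ->]] := KL x.
by exists l => //; exists k => //; rewrite addrC.
Qed.

(** The last hypothesis says both that [f] is injective on [K] and that its image there meets [L]
    trivially. So each [y] has exactly one [k] in [K] with [y - f k] in [L], and this uniqueness
    makes the chosen map linear. *)
Lemma linear_retraction f K L : submod_closed K -> submod_closed L ->
    (forall y, exists2 k, k \in K & exists2 l, l \in L & y = f k + l) ->
    (forall k, k \in K -> f k \in L -> k = 0) ->
  exists g : {linear M -> M},
    forall k l, k \in K -> l \in L -> g (f k + l) = k.
Proof.
move=> cK cL KL KL0.
have /choice[h hP] : forall y, exists k, k \in K /\ y - f k \in L.
  move=> y; have [k kK [l lL ->]] := KL y.
  by exists k; split=> //; rewrite addrAC subrr add0r.
have hE y k : k \in K -> y - f k \in L -> h y = k.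
  move=> kK kL; have [hK hL] := hP y.
  apply/eqP; rewrite -subr_eq0; apply/eqP/KL0; first exact: submodB.
  rewrite linearB /=.
  have -> : f (h y) - f k = (y - f k) - (y - f (h y)).
    by rewrite opprB [RHS]addrC addrA subrK.
  exact: submodB.
have h_lin : linear h.
  move=> a u v; have [huK huL] := hP u; have [hvK hvL] := hP v.
  apply: hE; first by case: cK => _; apply.
  rewrite linearP opprD addrACA -scalerBr.
  by case: cL => _; apply.
pose g : {linear M -> M} := HB.pack h (GRing.isLinear.Build _ _ _ _ h h_lin).
exists g => k l kK lL; apply: hE => //.
by rewrite addrAC subrr add0r.
Qed.

Lemma projection K L : complements K L ->
  exists p : {linear M -> M}, forall k l, k \in K -> l \in L -> p (k + l) = k.
Proof. by move=> [cK cL KL KL0]; exact: (linear_retraction (f := idfun)). Qed.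

Definition submod_image f K : {pred M} :=
  [pred y | `[< exists2 x, x \in K & f x = y >]].

Lemma submod_imageP f K y :
  reflect (exists2 x, x \in K & f x = y) (y \in submod_image f K).
Proof. by rewrite inE; exact: asboolP. Qed.

Lemma submod_image_closed f K :
  submod_closed K -> submod_closed (submod_image f K).
Proof.
move=> [K0 cK]; split; first by apply/submod_imageP; exists 0; rewrite ?raddf0.
move=> a _ _ /submod_imageP[x xK <-] /submod_imageP[y yK <-].
by apply/submod_imageP; exists (a *: x + y); [exact: cK|rewrite linearP].
Qed.

(** The isomorphism is the inverse of [f], going from the image back to [K], which is the direction
    (C2) asks for. *)
Lemma submod_isomorphic_image f K : submod_closed K ->
    (forall x, x \in K -> f x = 0 -> x = 0) ->
  submod_isomorphic (submod_image f K) K.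
Proof.
move=> cK f_inj.
have injf : {in K &, injective f}.
  move=> x y xK yK fxy; apply/eqP; rewrite -subr_eq0; apply/eqP/f_inj.
    exact: submodB.
  by rewrite linearB /= fxy subrr.
have /choice[h hP] :
    forall y, exists x, y \in submod_image f K -> x \in K /\ f x = y.
  move=> y.
  case: (boolP (y \in submod_image f K)) => [/submod_imageP[x xK <-]|].
    by exists x.
  by exists 0.
have [_ cfK] := submod_image_closed f cK.
exists h; split.
- move=> x y xfK yfK; have [hxK fhx] := hP _ xfK; have [hyK fhy] := hP _ yfK.
  have [] := hP (x + y); first exact: submodD (submod_image_closed f cK) _ _.
  move=> hK fh; apply: injf => //; first exact: submodD.
  by rewrite fh linearD /= fhx fhy.
- move=> a x xfK; have [hxK fhx] := hP _ xfK.
  have [] := hP (a *: x); first exact: submodZ (submod_image_closed f cK) _.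
  move=> hK fh; apply: injf => //; first exact: submodZ.
  by rewrite fh linearZ /= fhx.
- by move=> x /hP[].
- by move=> x y /hP[_ {2}<-] /hP[_ {2}<-] ->.
- move=> x xK.
  have fxK : f x \in submod_image f K by apply/submod_imageP; exists x.
  by have [hK fh] := hP _ fxK; exists (f x) => //; exact: injf.
Qed.

Lemma summand_image f K : module_C2 M -> direct_summand K ->
  (forall x, x \in K -> f x = 0 -> x = 0) -> direct_summand (submod_image f K).
Proof.
move=> C2 sK f_inj; have [cK _] := sK.
by apply: C2 sK _; [exact: submod_image_closed|exact: submod_isomorphic_image].
Qed.

(* The content of condition (C3). *)
Lemma complement_containing A P : module_C2 M ->
    direct_summand A -> direct_summand P ->
    (forall x, x \in A -> x \in P -> x = 0) ->
  exists2 L, complements A L & {subset P <= L}.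
Proof.
move=> C2 [cA [B [cB AB AB0]]] sP AP0; have [cP _] := sP.
(* [q] is the projection onto [B] along [A]. *)
have [q qE] : exists q : {linear M -> M},
    forall b a, b \in B -> a \in A -> q (b + a) = b.
  by apply: projection; exact: complements_sym.
have qA a : a \in A -> q a = 0.
  by move=> aA; have [B0 _] := cB; have := qE _ _ B0 aA; rewrite add0r.
have qB b : b \in B -> q b = b.
  by move=> bB; have [A0 _] := cA; have := qE _ _ bB A0; rewrite addr0.
have q_in y : q y \in B.
  by have [a aA [b bB ->]] := AB y; rewrite addrC qE.
have q_ker y : y - q y \in A.
  by have [a aA [b bB ->]] := AB y; rewrite [a + b]addrC qE // addrAC subrr add0r.
(* The kernel [A] of [q] meets [P] trivially, so (C2) makes [q P] a summand, with complement [Q]. *)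
have [|_ [Q [cQ PQ PQ0]]] := summand_image (f := q) C2 sP.
  move=> x xP qx0; apply: AP0 => //.
  by have := q_ker x; rewrite qx0 subr0.
(* [L] is [P + (B ∩ Q)]. By the modular law [B] is the direct sum of [q P] and [B ∩ Q], and [P]
   agrees with [q P] modulo [A]; hence [L] can replace [B] as a complement of [A]. *)
pose inL y := exists2 p, p \in P & y - p \in B /\ y - p \in Q.
pose L : {pred M} := [pred y | `[< inL y >]].
have LP y : reflect (inL y) (y \in L).
  by rewrite inE; exact: asboolP.
have [[B0 _] [P0 _] [Q0 _]] := And3 cB cP cQ.
exists L; last first.
  by move=> p pP; apply/LP; exists p => //; rewrite subrr.
split=> //.
- split; first by apply/LP; exists 0; rewrite ?subr0.
  move=> a u v /LP[x xP [uB uQ]] /LP[y yP [vB vQ]]; apply/LP.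
  exists (a *: x + y); first by case: cP => _; apply.
  rewrite opprD addrACA -scalerBr.
  by split; [case: cB => _|case: cQ => _]; apply.
- move=> y; have [_ /submod_imageP[p pP <-] [l lQ qy]] := PQ (q y).
  have lB : l \in B.
    have -> : l = q y - q p by rewrite qy addrAC subrr add0r.
    exact: submodB.
  exists ((y - q y) - (p - q p)); first exact: submodB.
  exists (p + l); first by apply/LP; exists p => //; rewrite addrAC subrr add0r.
  have -> : l = q y - q p by rewrite qy addrAC subrr add0r.
  rewrite opprB addrA -(addrA (y - q y)) subrK -(addrA (y - q y)).
  by rewrite [q p + _]addrC !subrK.
- move=> y yA /LP[p pP [dB dQ]].
  (* Apply [q] to [y = p + (y - p)]: it kills [y] and fixes [y - p]. Thus [q p] lies in both [q P]
     and [Q]. *)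
  have qpy : q p = - (y - p).
    apply/eqP; rewrite -addr_eq0; apply/eqP.
    by rewrite -(qB _ dB) -raddfD /= addrC subrK qA.
  have qp0 : q p = 0.
    apply: PQ0; first by apply/submod_imageP; exists p.
    by rewrite qpy; exact: submodN.
  have yp : y = p by apply/eqP; rewrite -subr_eq0 -oppr_eq0 -qpy qp0.
  by apply: AP0 => //; rewrite yp.
Qed.

(** Essentiality is used twice: [N1 ∩ K2] vanishes because it meets [N2] trivially inside [K2], and
    then [K1 ∩ K2] vanishes because it meets [N1] trivially inside [K1]. *)
Lemma essential_disjoint N1 N2 K1 K2 :
    submod_closed N1 -> submod_closed K1 -> submod_closed K2 ->
    essential_in N1 K1 -> essential_in N2 K2 ->
    (forall x, x \in N1 -> x \in N2 -> x = 0) ->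
  forall x, x \in K1 -> x \in K2 -> x = 0.
Proof.
move=> cN1 cK1 cK2 [N1K1 ess1] [_ ess2] N12 x xK1 xK2.
have cI N K : submod_closed N -> submod_closed K ->
    submod_closed [pred z | (z \in N) && (z \in K)].
  move=> [N0 cN] [K0 cK]; split; first by rewrite inE N0.
  move=> a u v /andP[uN uK] /andP[vN vK].
  by apply/andP; split; [exact: cN|exact: cK].
apply: (ess1 [pred z | (z \in K1) && (z \in K2)]); first exact: cI.
- by move=> z /andP[].
- move=> z /andP[_ zK2] zN1.
  apply: (ess2 [pred z | (z \in N1) && (z \in K2)]); first exact: cI.
  + by move=> t /andP[].
  + by move=> t /andP[tN1 _]; exact: N12.
  + by rewrite inE zN1.
- by rewrite inE xK1.
Qed.

Lemma essential_refl N : submod_closed N -> essential_in N N.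
Proof. by move=> cN; split=> // L cL LN LN0 x xL; apply: LN0 => //; exact: LN. Qed.

(** In [Endo M] the conclusion puts the projection onto [L] along [K] into the right ideal generated
    by [f]. *)
Lemma projection_factors f K L : continuous_module M -> complements K L ->
    (forall x, f x = 0 -> x \in K) ->
  exists g : {linear M -> M},
    forall k l, k \in K -> l \in L -> g (f (k + l)) = l.
Proof.
move=> [C1 C2] KL fK; have [cK cL KLs KL0] := KL.
have sL : direct_summand L.
  by split=> //; have [_ _ ? ?] := complements_sym KL; exists K.
have f_inj x : x \in L -> f x = 0 -> x = 0 by move=> xL /fK xK; exact: KL0.
have sfL := summand_image C2 sL f_inj.
have cfL := submod_image_closed f cL; have cfK := submod_image_closed f cK.
have [P sP eP] := C1 _ cfK.
have [cP _] := sP.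
have dis : forall x, x \in submod_image f L -> x \in P -> x = 0.
  apply: (essential_disjoint cfL cfL cP (essential_refl cfL) eP).
  move=> _ /submod_imageP[l lL <-] /submod_imageP[k kK fkl].
  suff -> : l = 0 by rewrite raddf0.
  (* From [f l = f k], the difference [k - l] is in the kernel of [f], hence in [K], and so is
     [l]. *)
  apply: KL0 => //.
  have -> : l = k - (k - l) by rewrite opprB addrC subrK.
  by apply: submodB => //; apply: fK; rewrite linearB /= fkl subrr.
have [Q [_ cQ fLQ fLQ0] PQ] := complement_containing C2 sfL sP dis.
have [y||g gE] := linear_retraction (f := f) cL cQ.
- by have [_ /submod_imageP[l lL <-] [c cQ' ->]] := fLQ y; exists l => //; exists c.
- move=> l lL flQ; apply: f_inj => //; apply: fLQ0 => //.
  by apply/submod_imageP; exists l.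
exists g => k l kK lL; rewrite addrC raddfD /= gE //.
by apply: PQ; have [sub _] := eP; apply: sub; apply/submod_imageP; exists k.
Qed.

(** The two summands given by (C1) need not span [M]; the second is therefore absorbed into a
    complement of the first. *)
Lemma continuous_separate N1 N2 : continuous_module M ->
    submod_closed N1 -> submod_closed N2 ->
    (forall x, x \in N1 -> x \in N2 -> x = 0) ->
  exists K L, [/\ complements K L, {subset N1 <= K} & {subset N2 <= L}].
Proof.
move=> [C1 C2] cN1 cN2 N12.
have [K1 sK1 eK1] := C1 _ cN1; have [K2 sK2 eK2] := C1 _ cN2.
have [cK1 _] := sK1; have [cK2 _] := sK2.
have [L K1L K2L] :=
  complement_containing C2 sK1 sK2 (essential_disjoint cN1 cK1 cK2 eK1 eK2 N12).
exists K1, L; split=> // [|x xN2]; first by case: eK1.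
by apply: K2L; case: eK2 => sub _; exact: sub.
Qed.

End Decomposition.

(** * Computing with right coprime pairs through generators *)

Section RightCoprimePairs.
Variable T : pzRingType.
Implicit Types (a b e : T) (p q : RCP T).

Lemma principal_rightM a t : principal_right a (a * t).
Proof. by exists t. Qed.

Lemma right_coprimeP a b :
  right_coprime (a, b) <-> exists x y, a * x + b * y = 1.
Proof.
split=> [ab|[x [y xy]]].
  have : [set: T] 1 by [].
  by rewrite -ab => -[_ [x _ <-] [_ [y _ <-] <-]]; exists x, y.
apply/seteqP; split=> // z _; exists (a * (x * z)); first exact: principal_rightM.
exists (b * (y * z)); first exact: principal_rightM.
by rewrite !mulrA -mulrDl xy mul1r.
Qed.

Lemma principal_right_sub a b : principal_right a `<=` principal_right b <->
  exists t, a = b * t.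
Proof.
split=> [ab|[t ->] _ [u _ <-]].
  by have [t _ bt] := ab _ (principal_rightM a 1); exists t; rewrite bt mulr1.
by rewrite -mulrA; exact: principal_rightM.
Qed.

Lemma generators_le p q a b a' b' : generators p a b -> generators q a' b' ->
  (p <= q)%O <-> (exists t, a = a' * t) /\ (exists t, b = b' * t).
Proof.
move=> [u ua <-] [v va <-].
rewrite [X in is_true X]rcp_le_pi; split=> [/asboolP|tt]; last apply/asboolP.
  by rewrite /rcpair_le ua va /= => -[/principal_right_sub ? /principal_right_sub].
by case: tt => t1 t2; rewrite /rcpair_le ua va /=; split; apply/principal_right_sub.
Qed.

Lemma generators_coprime p a b :
  generators p a b -> exists x y, a * x + b * y = 1.
Proof.
by move=> [[ab ab1] /= ua _]; apply/right_coprimeP; rewrite -ua; exact/asboolP.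
Qed.

Lemma generators_repr p : exists a b, generators p a b.
Proof.
exists (val (repr p)).1, (val (repr p)).2.
by exists (repr p); [case: (val _)|exact: reprK].
Qed.

Lemma coprime_generators a b x y : a * x + b * y = 1 ->
  exists p, generators p a b.
Proof.
move=> xy; have ab : `[< right_coprime (a, b) >].
  by apply/asboolP/right_coprimeP; exists x, y.
by exists (\pi_(RCP T) (exist _ (a, b) ab)); exists (exist _ (a, b) ab).
Qed.

(** For a smaller pair with [a * x + b * y = 1], left multiplication by [e] fixes [a] and kills [b].
    This gives [e = a * x], hence [1 - e = b * y], so the pairs coincide. *)
Lemma idempotent_minimal e p : e * e = e -> generators p e (1 - e) ->
  minimal (<=%O : rel (RCP T)) p.
Proof.
move=> ee pe q; have [a [b qab]] := generators_repr q.
move=> /(generators_le qab pe)[[s as_] [t bt]].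
have [x [y xy]] := generators_coprime qab.
have ea : e * a = a by rewrite as_ mulrA ee.
have fb : e * b = 0 by rewrite bt mulrA mulrBr mulr1 ee subrr mul0r.
have eax : e = a * x.
  by rewrite -[e in LHS]mulr1 -xy mulrDr !mulrA ea fb mul0r addr0.
apply/(generators_le pe qab); split; first by exists x.
by exists y; rewrite -xy -eax addrC addrA addNr add0r.
Qed.

End RightCoprimePairs.

(** * Kernels along the chain and the lower bound *)

Lemma union_ker_closed (R : pzRingType) (M : lmodType R) (d : Order.disp_t)
    (I : orderType d) (f : I -> {linear M -> M}) :
    (forall i j x, (i <= j)%O -> f i x = 0 -> f j x = 0) ->
  submod_closed [pred x | `[< x = 0 \/ exists i, f i x = 0 >]].
Proof.
(* The disjunct [x = 0] supplies the zero vector when the chain is empty. *)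
move=> mono; split; first by rewrite inE; left.
move=> c u v; rewrite !inE => -[->|[i ui]]; first by rewrite scaler0 add0r.
case=> [->|[j vj]]; first by right; exists i; rewrite addr0 linearZ /= ui scaler0.
right; exists (Order.max i j); rewrite linearP.
by rewrite (mono i) ?le_max ?lexx // (mono j) ?le_max ?lexx ?orbT // scaler0 add0r.
Qed.

Theorem theorem3p11 (R : pzRingType) (M : lmodType R) :
  continuous_module M -> right_strongly_exchange (Endo M).
Proof.
move=> cM d I p _ [pdesc [a [b [_ [_ [gen _ _]]]]]].
pose A i : {linear M -> M} := a i; pose B i : {linear M -> M} := b i.
have ple i j : (i <= j)%O -> (p j <= p i)%O.
  by rewrite le_eqVlt => /predU1P[->|/pdesc].
(* [a j] is [a i] followed by some [t], so kernels grow along the chain. *)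
have monoA i j x : (i <= j)%O -> A i x = 0 -> A j x = 0.
  move=> /ple /(generators_le (gen j) (gen i))[[t at_] _] aix.
  rewrite /A at_; change ((t : {linear M -> M}) (A i x) = 0).
  by rewrite aix raddf0.
have monoB i j x : (i <= j)%O -> B i x = 0 -> B j x = 0.
  move=> /ple /(generators_le (gen j) (gen i))[_ [t bt]] bix.
  rewrite /B bt; change ((t : {linear M -> M}) (B i x) = 0).
  by rewrite bix raddf0.
(* Evaluate [a i * s + b i * t = 1] at [x]. *)
have AB i x : A i x = 0 -> B i x = 0 -> x = 0.
  have [s [t st]] := generators_coprime (gen i) => ax bx.
  have : (s : {linear M -> M}) (A i x) + (t : {linear M -> M}) (B i x) = x.
    by rewrite -[in RHS](_ : endo_fun (1 : Endo M) x = x) // -st.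
  by rewrite ax bx !raddf0 addr0.
have [|K [L [KL NK NL]]] :=
    continuous_separate cM (union_ker_closed monoA) (union_ker_closed monoB).
  move=> x; rewrite !inE => -[-> //|[i ax]] [//|[j bx]].
  by apply: (AB (Order.max i j)); [apply: (monoA i)|apply: (monoB j)];
    rewrite // le_max lexx ?orbT.
have kerA i x : A i x = 0 -> x \in K.
  by move=> ax; apply: NK; rewrite inE; right; exists i.
have kerB i x : B i x = 0 -> x \in L.
  by move=> bx; apply: NL; rewrite inE; right; exists i.
have LK := complements_sym KL.
(* Taking the complements in the order [L], [K] makes [e] the identity on [L] and zero on [K]. *)
have [e eE] := projection LK; pose E : Endo M := e.
have [_ _ KLs _] := KL.
have endo_eq (f g : Endo M) :
    (forall k l, k \in K -> l \in L ->
      endo_fun f (k + l) = endo_fun g (k + l)) -> f = g.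
  by move=> fg; apply: endoP => x; have [k kK [l lL ->]] := KLs x; exact: fg.
have E_add k l : k \in K -> l \in L -> endo_fun E (k + l) = l.
  by move=> kK lL; rewrite addrC; exact: eE.
have E1_add k l : k \in K -> l \in L -> endo_fun (1 - E) (k + l) = k.
  move=> kK lL; change (k + l - endo_fun E (k + l) = k).
  by rewrite E_add // addrK.
have EE : E * E = E.
  apply: endo_eq => k l kK lL.
  change (endo_fun E (endo_fun E (k + l)) = endo_fun E (k + l)).
  rewrite E_add //; have [[K0 _] _ _ _] := KL.
  by have := E_add _ _ K0 lL; rewrite add0r.
have [q qE] : exists q, generators q E (1 - E).
  by apply: (@coprime_generators _ _ _ 1 1); rewrite !mulr1 addrC subrK.
exists q; split; last exact: idempotent_minimal EE qE.
move=> i; apply/(generators_le qE (gen i)); split.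
  have [g gE] := projection_factors cM KL (@kerA i).
  exists (g : Endo M); apply: endo_eq => k l kK lL; rewrite E_add //.
  by rewrite -[LHS](gE _ _ kK lL).
(* The roles of [K] and [L] are exchanged, since the kernel of [B i] lies in [L] and [1 - E]
   projects onto [K]. *)
have [g gE] := projection_factors cM LK (@kerB i).
exists (g : Endo M); apply: endo_eq => k l kK lL; rewrite E1_add //.
by rewrite -[LHS](gE _ _ lL kK) addrC.
Qed.
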